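(* Let $q$ be a prime power, $1\le l\le k$ and $t\ge1$ integers, and let $f:\mathbb{F}_q^k\to\mathbb{F}_q^l$ be a linear function of rank $l$. If there exists an $(f,t)$-FCC of redundancy $r$, then $$ q^r\ \ge\ 1-\frac{\lambda_{\max}(r)}{\lambda_{\min}(r)},$$ where $\lambda_{\max}(r)$ and $\lambda_{\min}(r)$ denote the maximum and minimum eigenvalues, respectively, of the adjacency matrix of the graph $\mathcal{G}_f(t,k,r)$.
   Context: $d_H$ is Hamming distance. An $(f,t)$-FCC of redundancy $r$ is a systematic encoding $\mathfrak{E}:\mathbb{F}_q^k\to\mathbb{F}_q^{k+r}$, $\mathfrak{E}(\mathbf{u})=(\mathbf{u},\mathbf{p}(\mathbf{u}))$ with $\mathbf{p}(\mathbf{u})\in\mathbb{F}_q^r$, such that $d_H(\mathfrak{E}(\mathbf{u}),\mathfrak{E}(\mathbf{u}'))\ge 2t+1$ whenever $f(\mathbf{u})\ne f(\mathbf{u}')$. $\mathcal{G}_f(t,k,r)$ is the simple graph with vertex set $\mathbb{F}_q^k\times\mathbb{F}_q^r$ in which two distinct vertices $\mathbf{v}_i=(\mathbf{u}_i,\mathbf{r}_i)$, $\mathbf{v}_j=(\mathbf{u}_j,\mathbf{r}_j)$ are adjacent iff either $\mathbf{u}_i=\mathbf{u}_j$, or $f(\mathbf{u}_i)\neq f(\mathbf{u}_j)$ and $d_H(\mathbf{v}_i,\mathbf{v}_j)<2t+1$. *)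

(* Defs.v *)
From HB Require Import structures.
From mathcomp Require Import all_boot all_order all_algebra.
From mathcomp Require Import reals.
Set Implicit Arguments.
Unset Strict Implicit.
Unset Printing Implicit Defensive.
Import Order.TTheory GRing.Theory Num.Theory.
Local Open Scope ring_scope.

Definition hamming (F : finFieldType) (n : nat) (x y : 'rV[F]_n) : nat :=
  #|[set i : 'I_n | x 0 i != y 0 i]|.

Definition systematic (F : finFieldType) (k r : nat)
    (E : 'rV[F]_k -> 'rV[F]_(k + r)) : Prop :=
  exists p : 'rV[F]_k -> 'rV[F]_r, forall u, E u = row_mx u (p u).

Definition is_FCC (F : finFieldType) (k l r : nat)
    (f : 'rV[F]_k -> 'rV[F]_l) (t : nat)
    (E : 'rV[F]_k -> 'rV[F]_(k + r)) : Prop :=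
  systematic E /\
  forall u u' : 'rV[F]_k, f u <> f u' ->
    ((2 * t).+1 <= hamming (E u) (E u'))%N.

(* F^k x F^r is kept as a product; a pair is read as the concatenated word of
   length k + r when measuring Hamming distance. *)
Definition fcc_vertex (F : finFieldType) (k r : nat) : finType :=
  ('rV[F]_k * 'rV[F]_r)%type.

Definition fcc_graph (F : finFieldType) (k l : nat)
    (f : 'rV[F]_k -> 'rV[F]_l) (t r : nat) : rel (fcc_vertex F k r) :=
  fun v w =>
    (v != w) &&
    ((v.1 == w.1) ||
     (f v.1 != f w.1) &&
     (hamming (row_mx v.1 v.2) (row_mx w.1 w.2) < (2 * t).+1)%N).

(* Rows and columns are indexed by the position of a vertex in [enum V]. *)
Definition adjacency_mx (R : realType) (V : finType) (e : rel V) :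
    'M[R]_#|V| :=
  \matrix_(i, j) (e (enum_val i) (enum_val j))%:R.

Definition is_max_eigenvalue (R : realType) (n : nat) (A : 'M[R]_n) (a : R) :
    Prop :=
  eigenvalue A a /\ forall b : R, eigenvalue A b -> b <= a.

Definition is_min_eigenvalue (R : realType) (n : nat) (A : 'M[R]_n) (a : R) :
    Prop :=
  eigenvalue A a /\ forall b : R, eigenvalue A b -> a <= b.

(* Main.v *)
(** An FCC with parity map [p] properly colours the graph with the [q ^ r]
    colours [w - p u] of the vertices [(u, w)], so the claim is Hoffman's lower
    bound on the number of colours. To get that bound, let [v] be an eigenvector
    for [a], let [v_s] be its restriction to the colour class [s], and put
    [y_s = v - q v_s] for [q] colours. Summing
    [lmin |y_s|^2 <= y_s A y_s^T] over [s] gives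
    [lmin q (q - 1) |v|^2 <= - a q |v|^2], since [v_s A v_s^T = 0]. *)

Require Import Defs.
From HB Require Import structures.
From mathcomp Require Import all_boot all_order all_algebra.
From mathcomp Require Import reals.
From mathcomp Require Import complex ring lra.
Set Implicit Arguments.
Unset Strict Implicit.
Unset Printing Implicit Defensive.
Import Order.TTheory GRing.Theory Num.Theory.
Local Open Scope ring_scope.
Local Open Scope sesquilinear_scope.

(** With [P] the spectral matrix and [D] the diagonal one, [A = P^-1 D P] gives [P A = D P], so row
    [i] of [P] is an eigenvector. *)
Lemma eigenvalue_spectral_diag (C : numClosedFieldType) n (A : 'M[C]_n) i :
  A \is normalmx -> eigenvalue A (spectral_diag A 0 i).
Proof.
move=> /orthomx_spectralP A_eq.
apply/eigenvalueP; exists (row i (spectralmx A)); last first.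
  apply/eqP => rP0; have := spectral_unit A.
  rewrite -row_free_unit => /row_freeP[B PB].
  have := congr1 (row i) PB; rewrite row_mul rP0 mul0mx row1.
  by move/rowP/(_ i)/eqP; rewrite !mxE !eqxx eq_sym oner_eq0.
rewrite -row_mul [X in spectralmx A *m X]A_eq !mulmxA mulmxV ?spectral_unit //.
by rewrite mul1mx row_mul row_diag_mx -scalemxAl -rowE.
Qed.

(** Over [complex R], [A] is diagonalised by a unitary [P]. In the coordinates [y = x P^t*], the two
    forms are the sums of [|y_i|^2] with weights [m] and [d_i], and each [d_i] is at least [m]. *)
Lemma le_min_eigenvalue_quadratic (R : rcfType) n (A : 'M[R]_n) (m : R)
    (x : 'rV[R]_n) :
  A^T = A -> (forall a, eigenvalue A a -> m <= a) ->
  m * (x *m x^T) 0 0 <= (x *m A *m x^T) 0 0.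
Proof.
move=> symA m_min; pose phi : {rmorphism R -> complex R} := real_complex R.
have phi_real a : phi a \is Num.real.
  by rewrite CrealE; apply/eqP; exact: conjc_real.
set Ac := map_mx phi A; set P := spectralmx Ac; set d := spectral_diag Ac.
have Aherm : Ac \is hermsymmx.
  apply/is_hermitianmxP/matrixP => i j.
  by rewrite expr0 scale1r !mxE -{1}symA mxE; exact/esym/CrealP.
have Anormal := hermitian_normalmx Aherm.
have Ac_eq : Ac = P^t* *m diag_mx d *m P.
  by rewrite -invmx_unitary ?spectral_unitarymx //; apply/orthomx_spectralP.
have P_unit : P^t* *m P = 1%:M.
  by rewrite -invmx_unitary ?spectral_unitarymx // mulVmx // spectral_unit.
(* The hypothesis on [m] only speaks of eigenvalues in [R]. Since [Ac] is hermitian, [d_i] has zero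
   imaginary part, so it is the image of an eigenvalue of [A]. *)
have d_ge i : phi m <= d 0 i.
  have /mxOverP/(_ 0 i) := hermitian_spectral_diag_real Aherm.
  have := eigenvalue_spectral_diag i Anormal; rewrite -/d.
  case: (d 0 i) => a b eig; rewrite CrealE => /eqP[] /eqP.
  rewrite eq_sym -addr_eq0 -mulr2n mulrn_eq0 /= => /eqP b0.
  move: eig; rewrite b0 (eigenvalue_map phi A a) => /m_min m_le.
  by rewrite lecR.
set xc := map_mx phi x; pose y := xc *m P^t*.
have xcT : map_mx phi x^T = xc^t*.
  by apply/matrixP=> i j; rewrite !mxE; exact/esym/CrealP.
have yT : y^t* = P *m xc^t*.
  by rewrite /y trmx_mul map_mxM trmxCK.
have normE : phi ((x *m x^T) 0 0) = \sum_i `|y 0 i| ^+ 2.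
  transitivity ((xc *m (P^t* *m P) *m xc^t*) 0 0).
    by rewrite P_unit mulmx1 -xcT -map_mxM [in RHS]mxE.
  rewrite !mulmxA -/y -mulmxA -yT mxE; apply: eq_bigr => i _.
  by rewrite !mxE normCK.
have quadE : phi ((x *m A *m x^T) 0 0) = \sum_i d 0 i * `|y 0 i| ^+ 2.
  transitivity ((xc *m Ac *m xc^t*) 0 0).
    by rewrite -xcT -!map_mxM [in RHS]mxE.
  rewrite Ac_eq !mulmxA -/y -mulmxA -yT mxE; apply: eq_bigr => i _.
  by rewrite mul_mx_diag !mxE normCK mulrAC mulrC.
rewrite -lecR -!/(phi _) rmorphM normE quadE mulr_sumr.
by apply: ler_sum => i _; rewrite ler_wpM2r // exprn_ge0.
Qed.

Lemma hoffman_coloring_mx (R : rcfType) (n : nat) (C : finType)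
    (A : 'M[R]_n) (c : 'I_n -> C) (a m : R) :
  A^T = A -> (forall i j, c i = c j -> A i j = 0) ->
  eigenvalue A a -> (forall b, eigenvalue A b -> m <= b) ->
  m * (#|C|%:R - 1) <= - a.
Proof.
move=> symA A0 /eigenvalueP[v vA v_neq0] m_min.
set q : R := #|C|%:R.
pose part s : 'rV[R]_n := \row_j (if c j == s then v 0 j else 0).
pose N s := \sum_(j | c j == s) v 0 j ^+ 2.
pose S := \sum_j v 0 j ^+ 2.
have sumN : \sum_s N s = S by rewrite /S (partition_big c predT).
have sq_vv : (v *m v^T) 0 0 = S.
  by rewrite mxE; apply: eq_bigr => j _; rewrite mxE expr2.
have v_part s : (v *m (part s)^T) 0 0 = N s.
  rewrite /N mxE [RHS]big_mkcond; apply: eq_bigr => j _.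
  by rewrite !mxE; case: ifP; rewrite ?mulr0 ?expr2.
have part_v s : (part s *m v^T) 0 0 = N s.
  by rewrite -v_part -[in RHS](trmxK v) -trmx_mul [RHS]mxE.
have part_part s : (part s *m (part s)^T) 0 0 = N s.
  rewrite /N mxE [RHS]big_mkcond; apply: eq_bigr => j _.
  by rewrite !mxE; case: ifP; rewrite ?mulr0 ?expr2.
have Av : A *m v^T = a *: v^T.
  by rewrite -[A]symA -trmx_mul vA linearZ.
(* Only entries of [A] with both indices of colour [s] could contribute, and these vanish. *)
have part_A_part s : (part s *m A *m (part s)^T) 0 0 = 0.
  rewrite mxE big1 // => j _; rewrite !mxE.
  case: eqP => [cj|]; last by rewrite mulr0.
  rewrite big1 ?mul0r // => i _; rewrite mxE.
  case: eqP => [ci|]; last by rewrite mul0r.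
  by rewrite A0 ?mulr0 // ci.
have entryB (M M' : 'M[R]_1) : (M - M') 0 0 = M 0 0 - M' 0 0 by rewrite !mxE.
have entryZ b (M : 'M[R]_1) : (b *: M) 0 0 = b * M 0 0 by rewrite mxE.
pose y s := v - q *: part s.
have yT s : (y s)^T = v^T - q *: (part s)^T by rewrite /y linearB linearZ.
have yy s : (y s *m (y s)^T) 0 0 = S - 2 * q * N s + q ^+ 2 * N s.
  rewrite yT mulmxBr /y !mulmxBl -!scalemxAr -!scalemxAl.
  by rewrite !(entryB, entryZ) sq_vv v_part part_v part_part; ring.
have yAy s : (y s *m A *m (y s)^T) 0 0 = a * S - 2 * q * a * N s.
  rewrite yT /y mulmxBr !mulmxBl -!scalemxAl -!scalemxAr.
  rewrite vA -scalemxAl -[part s *m A *m v^T]mulmxA Av -!scalemxAl -scalemxAr.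
  by rewrite !(entryB, entryZ) sq_vv v_part part_v part_A_part; ring.
have S_gt0 : 0 < S.
  rewrite lt_neqAle eq_sym sumr_ge0 ?andbT => [|j _]; last exact: sqr_ge0.
  apply: contraNneq v_neq0 => S0; apply/eqP/rowP => j; rewrite mxE.
  have /eqP : v 0 j ^+ 2 = 0 by apply: (psumr_eq0P _ S0) => // i _; exact: sqr_ge0.
  by rewrite sqrf_eq0 => /eqP.
have q_gt0 : 0 < q.
  have [i _] : exists i, v 0 i != 0 by apply/rV0Pn.
  by rewrite ltr0n; apply/card_gt0P; exists (c i).
have : \sum_s m * (y s *m (y s)^T) 0 0 <= \sum_s (y s *m A *m (y s)^T) 0 0.
  by apply: ler_sum => s _; exact: le_min_eigenvalue_quadratic.
rewrite -mulr_sumr (eq_bigr _ (fun s _ => yy s)) (eq_bigr _ (fun s _ => yAy s)).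
rewrite big_split sumrB /= sumrB !sumr_const -!mulr_sumr sumN.
rewrite -(mulr_natr S) -(mulr_natr (a * S)) -/q => le_sums.
(* The sums are [m (q - 2q + q^2) S] and [a (q - 2q) S]; the common factor [q S] is positive. *)
by rewrite -(ler_pM2r (mulr_gt0 q_gt0 S_gt0)); lra.
Qed.

Lemma hoffman_coloring (R : realType) (V C : finType) (e : rel V)
    (c : V -> C) (a m : R) :
  symmetric e -> (forall v w, e v w -> c v != c w) ->
  eigenvalue (adjacency_mx R e) a -> is_min_eigenvalue (adjacency_mx R e) m ->
  1 - a / m <= #|C|%:R.
Proof.
move=> sym_e proper_c eig_a [_ m_min].
have symA : (adjacency_mx R e)^T = adjacency_mx R e.
  by apply/matrixP => i j; rewrite !mxE sym_e.
have bound : m * (#|C|%:R - 1) <= - a.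
  apply: (hoffman_coloring_mx (c := c \o enum_val)) symA _ eig_a m_min.
  move=> i j /= cij; rewrite mxE.
  by case: (boolP (e _ _)) => // /proper_c; rewrite cij eqxx.
have C_gt0 : (0 < #|C|)%N.
  have /eigenvalueP[x _ /rV0Pn[i _]] := eig_a.
  by apply/card_gt0P; exists (c (enum_val i)).
(* Dividing [bound] by [m] works for [m < 0]. If [m > 0], then [a >= m] makes the left side at most
   1; if [m = 0], the convention [a / 0 = 0] makes it exactly 1. *)
have [m_lt0|m_gt0|m0] := ltrgtP m 0.
- have : - a / m <= #|C|%:R - 1 by rewrite ler_ndivrMr // mulrC.
  by rewrite mulNr; lra.
- have : 0 <= a / m by rewrite divr_ge0 // ltW // (lt_le_trans m_gt0) ?m_min.
  have : 1 <= #|C|%:R :> R by rewrite ler1n.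
  lra.
- by rewrite m0 invr0 mulr0 subr0 ler1n.
Qed.

Lemma fcc_graph_sym (F : finFieldType) (k l t r : nat)
    (f : 'rV[F]_k -> 'rV[F]_l) :
  symmetric (fcc_graph f t (r := r)).
Proof.
move=> v w; rewrite /fcc_graph eq_sym (eq_sym v.1) (eq_sym (f v.1)).
congr (_ && (_ || _ && (_ < _)%N)); apply: eq_card => i.
by rewrite !inE eq_sym.
Qed.

(** Equal colours mean [a - a' = p u - p u']. If [u = u'], the vertices coincide; otherwise their
    words differ in the same positions as the two codewords, hence in at least [2t + 1] places. *)
Lemma fcc_graph_coloring (F : finFieldType) (k l t r : nat)
    (f : 'rV[F]_k -> 'rV[F]_l) (p : 'rV[F]_k -> 'rV[F]_r) :
  is_FCC f t (fun u => row_mx u (p u)) ->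
  forall v w, fcc_graph f t (r := r) v w -> v.2 - p v.1 != w.2 - p w.1.
Proof.
move=> [_ dist_p] [u a] [u' a'] /andP[/= neq adj]; apply/eqP => same.
case/orP: adj => [/eqP uu'|/andP[/eqP fuu' lt_dist]].
  by case/eqP: neq; rewrite uu' in same *; rewrite (addIr _ same).
have := dist_p u u' fuu'; rewrite leqNgt => /negP; apply.
rewrite (_ : hamming _ _ = hamming (row_mx u a) (row_mx u' a')) //.
apply: eq_card => i; rewrite !inE; case: (split_ordP i) => j ->.
  by rewrite !row_mxEl.
rewrite !row_mxEr; have /rowP/(_ j) := same; rewrite !mxE => eq_j.
(* Translation by the common colour entry sends the parity entries of [u] and [u'] to those of [a]
   and [a']. *)
by rewrite -(inj_eq (addrI (a 0 j - p u 0 j))) subrK eq_j subrK.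
Qed.

Theorem corollary8 (R : realType) (F : finFieldType) (k l t r : nat)
    (f : {linear 'rV[F]_k -> 'rV[F]_l}) (lmax lmin : R) :
  (1 <= l)%N -> (l <= k)%N -> (1 <= t)%N ->
  \rank (lin1_mx f) = l ->
  (exists E : 'rV[F]_k -> 'rV[F]_(k + r), is_FCC f t E) ->
  is_max_eigenvalue (adjacency_mx R (fcc_graph f t (r := r))) lmax ->
  is_min_eigenvalue (adjacency_mx R (fcc_graph f t (r := r))) lmin ->
  1 - lmax / lmin <= (#|F| ^ r)%:R.
Proof.
move=> _ _ _ _ [E [[p E_eq] dist_E]] [eig_max _] min_eig.
have fcc_p : is_FCC f t (fun u => row_mx u (p u)).
  by split; [exists p | move=> u u'; rewrite -!E_eq; exact: dist_E].
have := hoffman_coloring (@fcc_graph_sym F k l t r f)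
  (fcc_graph_coloring fcc_p) eig_max min_eig.
(* The colours are the row vectors of length [r] over [F]. *)
by rewrite card_mx mul1n.
Qed.
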